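(* Under the Median Stationing (MS) algorithm, the coverage costs $T_{\mathrm{MS}}^{\mathrm{DI}}$ and $T_{\mathrm{MS}}^{\mathrm{DD}}$ of a team of $m$ DI, resp. DD, robots in a square $\mathcal{Q}$ of area $\mathcal{A}$ satisfy $$\frac{\mathcal{H}^*_m(\mathcal{Q})}{v_{\max}}\le T_{\mathrm{MS}}^{\mathrm{DI}}\le \frac{\mathcal{H}^*_m(\mathcal{Q})}{v_{\max}}+\frac{v_{\max}}{2u_{\max}}+\sqrt{\frac{2\sqrt{2\mathcal{A}}}{u_{\max}}},$$ $$\frac{\mathcal{H}^*_m(\mathcal{Q})}{w_{\max}}\le T_{\mathrm{MS}}^{\mathrm{DD}}\le \frac{\mathcal{H}^*_m(\mathcal{Q})}{w_{\max}}+\frac{\rho\pi}{2w_{\max}}.$$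
   Context: Environment: $\mathcal{Q}\subset\mathbb{R}^2$ is a square of area $\mathcal{A}$. Service requests are generated by a spatio-temporal Poisson process with time intensity $\lambda>0$ and uniform spatial density on $\mathcal{Q}$; a request is fulfilled when one of $m$ identical robots moves to its location. For a policy $\pi$, if $T_j$ is the time between generation of the $j$-th request and its fulfillment, the coverage cost is $T_\pi=\lim_{j\to+\infty}\lim_{\lambda\to0^+}\mathrm{E}[T_j]$. Double integrator (DI) robot: state $(x,y,v_x,v_y)\in\mathbb{R}^4$ with $\dot x=v_x$, $\dot y=v_y$, $\dot v_x=u_x$, $\dot v_y=u_y$, $v_x^2+v_y^2\le v_{\max}^2$, $u_x^2+u_y^2\le u_{\max}^2$. Differential drive (DD) robot: state $(x,y,\theta)\in SE(2)$ with $\dot x=\tfrac12(w_l+w_r)\cos\theta$, $\dot y=\tfrac12(w_l+w_r)\sin\theta$, $\dot\theta=\tfrac{1}{2\rho}(w_r-w_l)$, $|w_l|,|w_r|\le w_{\max}$, $\rho>0$. Continuous $m$-median: $\mathcal{H}_m(p,\mathcal{Q})=\frac{1}{\mathcal{A}}\int_{\mathcal{Q}}\min_i\|p_i-q\|\,dq$ for $p\in\mathcal{Q}^m$; $\mathcal{H}^*_m(\mathcal{Q})$ is its global minimum and a minimizer $p^*=(p_1^*,\dots,p_m^* )$ gives the $m$-median locations. Median Stationing (MS) algorithm: the $m$ robots are placed at rest at the $m$-median locations $p_1^*,\dots,p_m^*$ (their stationary locations); for DD robots the heading is arbitrary. When a request appears, it is assigned to the robot whose stationary location is closest to the request location; that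 robot travels to the request location along a minimum-time path (with no terminal constraint other than position), and, in the absence of outstanding requests, returns to its stationary location (at rest, for DI robots). *)

(* Defs.v *)
From HB Require Import structures.
From mathcomp Require Import all_boot all_order all_algebra.
From mathcomp Require Import all_classical all_reals all_analysis.
Set Implicit Arguments. Unset Strict Implicit. Unset Printing Implicit Defensive.
Import Order.TTheory GRing.Theory Num.Theory.
Import numFieldNormedType.Exports.
Local Open Scope classical_set_scope.
Local Open Scope ring_scope.

Section Defs.
Variable R : realType.

Definition pt := (R * R)%type.

Definition dist (p q : pt) : R :=
  Num.sqrt ((p.1 - q.1) ^+ 2 + (p.2 - q.2) ^+ 2).

Definition square (a b s : R) : set pt :=
  [set q | a <= q.1 <= a + s /\ b <= q.2 <= b + s].

Definition leb := (@lebesgue_measure R).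

Definition leb2 := (leb \x leb)%E.

Definition int0 (t : R) (f : R -> R) : R :=
  Rintegral leb [set s | 0 <= s <= t] f.

(* A double-integrator robot starting at rest at p can be at position q at
   time T >= 0: there are measurable controls (ux, uy) with |u| <= umax, the
   velocity v(t) = int_0^t u satisfies |v| <= vmax on [0, T], and the
   position p + int_0^T v equals q. *)
Definition DI_reach (vmax umax : R) (p q : pt) (T : R) : Prop :=
  0 <= T /\
  exists ux uy : R -> R,
    measurable_fun setT ux /\ measurable_fun setT uy /\
    (forall t, 0 <= t <= T -> ux t ^+ 2 + uy t ^+ 2 <= umax ^+ 2) /\
    (forall t, 0 <= t <= T ->
        (int0 t ux) ^+ 2 + (int0 t uy) ^+ 2 <= vmax ^+ 2) /\
    p.1 + int0 T (fun t => int0 t ux) = q.1 /\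
    p.2 + int0 T (fun t => int0 t uy) = q.2.

Definition DI_time (vmax umax : R) (p q : pt) : \bar R :=
  ereal_inf [set T%:E | T in DI_reach vmax umax p q].

Definition DD_reach (wmax rho : R) (p : pt) (theta0 : R) (q : pt) (T : R)
    : Prop :=
  0 <= T /\
  exists wl wr : R -> R,
    measurable_fun setT wl /\ measurable_fun setT wr /\
    (forall t, 0 <= t <= T -> `|wl t| <= wmax /\ `|wr t| <= wmax) /\
    let theta t := theta0 + int0 t (fun s => (wr s - wl s) / (2 * rho)) in
    p.1 + int0 T (fun t => (wl t + wr t) / 2 * cos (theta t)) = q.1 /\
    p.2 + int0 T (fun t => (wl t + wr t) / 2 * sin (theta t)) = q.2.

Definition DD_time (wmax rho : R) (p : pt) (theta0 : R) (q : pt) : \bar R :=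
  ereal_inf [set T%:E | T in DD_reach wmax rho p theta0 q].

Definition closest (m : nat) (ps : 'I_m -> pt) (q : pt) (i : 'I_m) : bool :=
  [forall j, dist (ps i) q <= dist (ps j) q].

Definition Hm (m : nat) (Q : set pt) (A : R) (ps : 'I_m -> pt) : \bar R :=
  ((A^-1)%:E * \int[leb2]_(q in Q) (\big[Order.min/+oo%E]_(i < m) (dist (ps i) q)%:E))%E.

Definition Hstar (m : nat) (Q : set pt) (A : R) : \bar R :=
  ereal_inf [set Hm Q A ps | ps in [set ps : 'I_m -> pt | forall i, Q (ps i)]].

Definition is_median (m : nat) (Q : set pt) (A : R) (ps : 'I_m -> pt) : Prop :=
  (forall i, Q (ps i)) /\
  (forall ps' : 'I_m -> pt, (forall i, Q (ps' i)) -> (Hm Q A ps <= Hm Q A ps')%E).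

(* Light-load coverage cost of Median Stationing: all robots are at their
   stationary states when a request q (uniform on Q) arrives; it is served by
   the robot with closest stationary location, along a minimum-time path
   with travel time tau i q.  (Ties, a null set, resolved by the minimum.) *)
Definition MS_cost (m : nat) (Q : set pt) (A : R) (ps : 'I_m -> pt)
    (tau : 'I_m -> pt -> \bar R) : \bar R :=
  ((A^-1)%:E * \int[leb2]_(q in Q)
      (\big[Order.min/+oo%E]_(i < m | closest ps q i) tau i q))%E.

End Defs.

(* Main.v *)
Require Import Defs.
From HB Require Import structures.
From mathcomp Require Import all_boot all_order all_algebra.
From mathcomp Require Import all_classical all_reals all_analysis.
From mathcomp Require Import measurable_realfun.
From mathcomp Require Import lra ring.
Import Order.TTheory GRing.Theory Num.Theory.
Import numFieldNormedType.Exports.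

(* A robot never moves faster than vmax (DI) or wmax (DD), so reaching q from
   its station p takes at least |p - q| / vmax.  Conversely, a DI robot that
   thrusts straight towards q until it reaches top speed and then coasts
   arrives within |p - q| / vmax + vmax / (2 umax), which is already below the
   stated bound; a DD robot, which may drive backwards, turns in place through
   at most pi / 2, in time rho pi / (2 wmax), and then drives straight at full
   speed.  Each request goes to the robot with the nearest station, so
   integrating these pointwise bounds over Q turns the distances into the
   m-median cost, which the median stations attain. *)

Set Implicit Arguments. Unset Strict Implicit. Unset Printing Implicit Defensive.
Local Open Scope classical_set_scope.
Local Open Scope ring_scope.

Section int0.
Variable R : realType.
Notation mu := (@lebesgue_measure R).
Implicit Types (a b c t A B M : R) (f g : R -> R).

Lemma int0E t f : int0 t f = \int[mu]_(s in `[0, t]) f s.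
Proof.
by rewrite /int0 /leb; congr Rintegral; apply/seteqP; split => x /=; rewrite in_itv.
Qed.

Lemma eq_int0 t f g : (forall s, 0 <= s <= t -> f s = g s) -> int0 t f = int0 t g.
Proof. by move=> fg; rewrite !int0E; apply: eq_Rintegral => s; rewrite inE/= in_itv/= => /fg. Qed.

Lemma bounded_integrable_itv a b M f : measurable_fun `[a, b] f ->
  (forall x, a <= x <= b -> `|f x| <= M) -> mu.-integrable `[a, b] (EFin \o f).
Proof.
move=> mf fM; apply: measurable_bounded_integrable => //.
  change (mu `[a, b]%classic < +oo)%E; rewrite lebesgue_measure_itv.
  by case: ifP => _; rewrite ?ltry.
exists M; split; first exact: num_real.
by move=> N /ltW MN x /=; rewrite in_itv => /fM /le_trans; apply.
Qed.

Lemma Rintegral_cst_itv a b c (l r : bool) : a <= b ->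
  \int[mu]_(s in [set` Interval (BSide l a) (BSide r b)]) c = c * (b - a).
Proof.
move=> ab; rewrite Rintegral_cst//= (lebesgue_measure_itv (Interval _ _))/= lte_fin.
by case: ltgtP ab => // -> _; rewrite subrr mulr0.
Qed.

Lemma measurable_step t1 A B : measurable_fun setT (fun s : R => if s <= t1 then A else B).
Proof. by apply: measurable_fun_ifT => //; exact: measurable_fun_ler. Qed.

Lemma int0_step_le t1 A B t : 0 <= t <= t1 ->
  int0 t (fun s => if s <= t1 then A else B) = A * t.
Proof.
move=> /andP[t0 tt1]; rewrite (@eq_int0 _ _ (fun=> A)); last first.
  by move=> s /andP[_ st]; rewrite (le_trans st tt1).
by rewrite int0E Rintegral_cst_itv// subr0.
Qed.

Lemma int0_split t1 t f : 0 <= t1 <= t -> mu.-integrable `[0, t] (EFin \o f) ->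
  int0 t f = int0 t1 f + \int[mu]_(s in `]t1, t]) f s.
Proof.
move=> /andP[t10 t1t] fi; rewrite !int0E -(Rintegral_itvB fi) ?bnd_simp//.
by rewrite addrC subrK.
Qed.

Lemma int0_step_ge t1 A B t : 0 <= t1 <= t ->
  int0 t (fun s => if s <= t1 then A else B) = A * t1 + B * (t - t1).
Proof.
move=> t1t; rewrite (int0_split t1t); last first.
  apply: (@bounded_integrable_itv _ _ (`|A| + `|B|)).
    exact: measurable_funS (measurable_step _ _ _).
  by move=> x _; case: ifP => _; rewrite ?lerDl ?lerDr.
case/andP: t1t => t10 t1t; rewrite int0_step_le ?t10 ?lexx//.
rewrite -(@Rintegral_cst_itv t1 t B false false)//; congr (_ + _).
by apply: eq_Rintegral => x; rewrite inE/= in_itv/= => /andP[/lt_geF ->].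
Qed.

Lemma int0_linear c t : 0 < t -> int0 t (fun s => c * s) = c * t ^+ 2 / 2.
Proof.
move=> t0; rewrite int0E /Rintegral (@continuous_FTC2 _ _ (fun x => c * x ^+ 2 / 2))//=.
- by rewrite expr0n/= mulr0 mul0r subr0.
- by apply: continuous_subspaceT => x; exact: mulrl_continuous.
- have cF : continuous (fun x : R => c * x ^+ 2 / 2).
    move=> x; apply: cvgM; last exact: cvg_cst.
    by apply: cvgM; [exact: cvg_cst|exact: exprn_continuous].
  split; [|exact: cvg_at_right_filter (cF _)|exact: cvg_at_left_filter (cF _)].
  by move=> x _; apply: derivableM => //; apply: derivableM => //; exact: exprn_derivable.
- move=> x _; rewrite derive1Mr; last by apply: derivableM => //; exact: exprn_derivable.
  rewrite derive1Ml; last exact: exprn_derivable.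
  rewrite exp_derive1/= expr1 -[2 *: x]/(2 * x).
  by rewrite mulrCA mulrAC divff ?mul1r// pnatr_eq0.
Qed.

Lemma int0_ramp k tau t : 0 < tau <= t ->
  int0 t (fun s => k * (if s <= tau then s else tau))
  = k * tau ^+ 2 / 2 + k * tau * (t - tau).
Proof.
move=> /andP[tau0 taut]; rewrite (@int0_split tau) ?(ltW tau0)//; last first.
  apply: (@bounded_integrable_itv _ _ (`|k| * t)).
    apply: measurable_funS (_ : measurable_fun setT _) => //.
    apply: measurable_funM; first exact: measurable_cst.
    by apply: measurable_fun_ifT => //; exact: measurable_fun_ler.
  move=> x /andP[x0 xt]; rewrite normrM ler_wpM2l//.
  by case: ifP => _; rewrite ger0_norm// ltW.
congr (_ + _).
  by rewrite -int0_linear//; apply: eq_int0 => s /andP[_ ->].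
rewrite -(@Rintegral_cst_itv tau t (k * tau) false false)//.
by apply: eq_Rintegral => x; rewrite inE/= in_itv/= => /andP[/lt_geF ->].
Qed.

Lemma measurable_int0 t f : 0 <= t -> mu.-integrable `[0, t] (EFin \o f) ->
  measurable_fun `[0, t] (fun s => int0 s f).
Proof.
move=> t0 fi; rewrite (_ : (fun s => int0 s f) = parameterized_integral mu 0 ^~ f).
  apply: subspace_continuous_measurable_fun; first exact: measurable_itv.
  exact: parameterized_integral_continuous.
by apply: funext => s; rewrite int0E.
Qed.

End int0.

Section vector_bounds.
Variable R : realType.
Notation mu := (@lebesgue_measure R).

Lemma normr_le_sqr (x M : R) : 0 <= M -> x ^+ 2 <= M ^+ 2 -> `|x| <= M.
Proof. by move=> M0 xM; rewrite ler_norml; apply/andP; split; nra. Qed.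

Lemma dot_le_norm (X Y a b M : R) : 0 <= M -> a ^+ 2 + b ^+ 2 <= M ^+ 2 ->
  X * a + Y * b <= Num.sqrt (X ^+ 2 + Y ^+ 2) * M.
Proof.
move=> M0 abM; set N := Num.sqrt _.
have N0 : 0 <= N := sqrtr_ge0 _.
have NE : N ^+ 2 = X ^+ 2 + Y ^+ 2 by rewrite sqr_sqrtr// addr_ge0// sqr_ge0.
have lagrange : (X * a + Y * b) ^+ 2 + (X * b - Y * a) ^+ 2
                = (X ^+ 2 + Y ^+ 2) * (a ^+ 2 + b ^+ 2) by ring.
have sqr_le : (X * a + Y * b) ^+ 2 <= (N * M) ^+ 2.
  rewrite exprMn NE; have := sqr_ge0 (X * b - Y * a); have := sqr_ge0 X.
  have := sqr_ge0 Y; nra.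
have := mulr_ge0 N0 M0; nra.
Qed.

(* With N the norm of the integral, N ^ 2 = \int (X fx + Y fy) <= N M T by
   Cauchy-Schwarz under the integral. *)
Lemma int0_vec_le (T M : R) (fx fy : R -> R) : 0 <= T -> 0 <= M ->
  measurable_fun `[0, T] fx -> measurable_fun `[0, T] fy ->
  (forall t, 0 <= t <= T -> fx t ^+ 2 + fy t ^+ 2 <= M ^+ 2) ->
  int0 T fx ^+ 2 + int0 T fy ^+ 2 <= (M * T) ^+ 2.
Proof.
move=> T0 M0 mx my fM.
set X := int0 T fx; set Y := int0 T fy; set N := Num.sqrt (X ^+ 2 + Y ^+ 2).
have NE : N ^+ 2 = X ^+ 2 + Y ^+ 2 by rewrite sqr_sqrtr// addr_ge0// sqr_ge0.
have fxM t : 0 <= t <= T -> `|fx t| <= M.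
  by move=> /fM fxyM; apply: normr_le_sqr => //; have := sqr_ge0 (fy t); lra.
have fyM t : 0 <= t <= T -> `|fy t| <= M.
  by move=> /fM fxyM; apply: normr_le_sqr => //; have := sqr_ge0 (fx t); lra.
have integrable_scaled (c : R) (f : R -> R) : measurable_fun `[0, T] f ->
    (forall t, 0 <= t <= T -> `|f t| <= M) ->
    mu.-integrable `[0, T] (EFin \o (fun t => c * f t)).
  move=> mf fbM; apply: (@bounded_integrable_itv _ _ _ (`|c| * M)).
    by apply: measurable_funM => //; exact: measurable_cst.
  by move=> t /fbM ftM; rewrite normrM ler_wpM2l.
have ix := integrable_scaled X fx mx fxM.
have iy := integrable_scaled Y fy my fyM.
have N_sqr : N ^+ 2 = \int[mu]_(t in `[0, T]) (X * fx t + Y * fy t).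
  rewrite NE RintegralD// !RintegralZl -?int0E ?expr2//.
    exact: bounded_integrable_itv my fyM.
  exact: bounded_integrable_itv mx fxM.
have N_le : N ^+ 2 <= N * (M * T).
  have -> : N * (M * T) = \int[mu]_(t in `[0, T]) (N * M).
    by rewrite Rintegral_cst_itv// subr0 mulrA.
  rewrite N_sqr.
  apply: le_Rintegral => //; first exact: (integrableD _ ix iy).
    by apply: (@bounded_integrable_itv _ _ _ `|N * M|) => //; exact: measurable_cst.
  by move=> t; rewrite /= in_itv/= => /fM; exact: dot_le_norm.
rewrite -NE; have := sqrtr_ge0 (X ^+ 2 + Y ^+ 2); have := mulr_ge0 M0 T0; nra.
Qed.

End vector_bounds.

Section distance.
Variable R : realType.
Implicit Types p q : pt R.

Lemma distC p q : dist p q = dist q p.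
Proof. by rewrite /dist -sqrrN opprB -[X in _ + X]sqrrN opprB. Qed.

Lemma sqr_dist p q : dist p q ^+ 2 = (q.1 - p.1) ^+ 2 + (q.2 - p.2) ^+ 2.
Proof. by rewrite distC sqr_sqrtr// addr_ge0// sqr_ge0. Qed.

Lemma dist_le p q (X Y D : R) : 0 <= D -> q.1 = p.1 + X -> q.2 = p.2 + Y ->
  X ^+ 2 + Y ^+ 2 <= D ^+ 2 -> dist p q <= D.
Proof.
rewrite distC /dist => D0 -> -> XYD; rewrite ![_ + _ - _]addrC !addKr.
by rewrite -(ger0_norm D0) -sqrtr_sqr ler_wsqrtr.
Qed.

Lemma dist_eq0 p q : dist p q = 0 -> q = p.
Proof.
move=> d0; have := sqr_dist p q; rewrite d0 expr0n/= => /esym/eqP; clear d0.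
rewrite paddr_eq0 ?sqr_ge0// !sqrf_eq0 !subr_eq0 => /andP[/eqP e1 /eqP e2].
by case: p q e1 e2 => ? ? [? ?]/= -> ->.
Qed.

Lemma dist_dir p q : exists ex ey : R,
  [/\ ex ^+ 2 + ey ^+ 2 = 1, q.1 = p.1 + dist p q * ex & q.2 = p.2 + dist p q * ey].
Proof.
have [d0|dne0] := eqVneq (dist p q) 0.
  by exists 1, 0; rewrite d0 !mul0r !addr0 (dist_eq0 d0) expr1n expr0n/= addr0.
exists ((q.1 - p.1) / dist p q), ((q.2 - p.2) / dist p q); split.
- by rewrite !expr_div_n -mulrDl -sqr_dist divff// sqrf_eq0.
- by rewrite mulrC divfK// addrC subrK.
- by rewrite mulrC divfK// addrC subrK.
Qed.

End distance.

Section travel_time_lower_bounds.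
Variable R : realType.
Notation mu := (@lebesgue_measure R).
Implicit Types p q : pt R.

Lemma DI_time_ge (vmax umax : R) p q : 0 < vmax -> 0 < umax ->
  ((dist p q / vmax)%:E <= DI_time vmax umax p q)%E.
Proof.
move=> v0 u0; apply/ereal_infP => _ [T [T0 [ux [uy [mux [muy [uM [vM [qx qy]]]]]]]] <-].
rewrite lee_fin ler_pdivrMr// mulrC.
have integrable_u (f g : R -> R) : measurable_fun setT f ->
    (forall t, 0 <= t <= T -> f t ^+ 2 + g t ^+ 2 <= umax ^+ 2) ->
    mu.-integrable `[0, T] (EFin \o f).
  move=> mf fgM; apply: (@bounded_integrable_itv _ _ _ umax); first exact: measurable_funS mf.
  by move=> t /fgM fgtM; apply: normr_le_sqr (ltW u0) _; have := sqr_ge0 (g t); lra.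
have iux := integrable_u ux uy mux uM.
have iuy : mu.-integrable `[0, T] (EFin \o uy).
  by apply: (integrable_u uy ux muy) => t /uM; rewrite addrC.
apply: (dist_le _ (esym qx) (esym qy)); first exact: mulr_ge0 (ltW v0) T0.
apply: int0_vec_le => //; [exact: ltW|exact: measurable_int0|exact: measurable_int0].
Qed.

Lemma DD_time_ge (wmax rho : R) p (th : R) q : 0 < wmax -> 0 < rho ->
  ((dist p q / wmax)%:E <= DD_time wmax rho p th q)%E.
Proof.
move=> w0 rho0; apply/ereal_infP => _ [T [T0 [wl [wr [mwl [mwr [wM /= [qx qy]]]]]]] <-].
rewrite lee_fin ler_pdivrMr// mulrC.
set omega := fun s => (wr s - wl s) / (2 * rho).
set theta := fun t => th + int0 t omega.
have momega : measurable_fun setT omega.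
  by apply: measurable_funM; [exact: measurable_funB|exact: measurable_cst].
have iomega : mu.-integrable `[0, T] (EFin \o omega).
  apply: (@bounded_integrable_itv _ _ _ ((wmax + wmax) / (2 * rho))).
    exact: measurable_funS momega.
  have rho2 : 0 <= (2 * rho)^-1 by rewrite invr_ge0 mulr_ge0// ltW.
  move=> t /wM[wlM wrM]; rewrite normrM (ger0_norm rho2) ler_wpM2r//.
  by rewrite (le_trans (ler_normB _ _))// lerD.
have mtheta : measurable_fun `[0, T] theta.
  by apply: measurable_funD; [exact: measurable_cst|exact: measurable_int0].
have mspeed : measurable_fun `[0, T] (fun t => (wl t + wr t) / 2).
  apply: measurable_funS (_ : measurable_fun setT _) => //.
  by apply: measurable_funM; [exact: measurable_funD|exact: measurable_cst].
apply: (dist_le _ (esym qx) (esym qy)); first exact: mulr_ge0 (ltW w0) T0.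
apply: int0_vec_le => //; first exact: ltW.
- apply: measurable_funM => //.
  exact: measurableT_comp (continuous_measurable_fun (@continuous_cos R)) mtheta.
- apply: measurable_funM => //.
  exact: measurableT_comp (continuous_measurable_fun (@continuous_sin R)) mtheta.
move=> t /wM; rewrite !ler_norml => -[/andP[wl1 wl2] /andP[wr1 wr2]].
rewrite !exprMn -mulrDr cos2Dsin2 mulr1 -exprMn.
have speed_lo : - wmax <= (wl t + wr t) / 2 by lra.
have speed_hi : (wl t + wr t) / 2 <= wmax by lra.
nra.
Qed.

End travel_time_lower_bounds.

Section DI_travel_time.
Variable R : realType.
Implicit Types p q : pt R.

Lemma DI_reach_rest (vmax umax : R) p : DI_reach vmax umax p p 0.
Proof.
have int0_0 t : int0 t (fun=> 0 : R) = 0.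
  by rewrite int0E Rintegral_cst ?mul0r//; exact: measurable_itv.
have velocity : (fun t => int0 t (fun=> 0 : R)) = fun=> 0.
  by apply: funext => t; exact: int0_0.
split=> //; exists (fun=> 0), (fun=> 0); rewrite velocity int0_0 !addr0.
split; first exact: measurable_cst.
split; first exact: measurable_cst.
by split; [|split=> //] => t _; rewrite ?int0_0 expr0n/= addr0 sqr_ge0.
Qed.

Lemma DI_reach_accel_coast (vmax umax : R) p (ex ey tau T : R) :
  0 <= umax -> ex ^+ 2 + ey ^+ 2 = 1 -> 0 < tau -> tau <= T -> umax * tau <= vmax ->
  let d := umax * tau * (T - tau / 2) in
  DI_reach vmax umax p (p.1 + d * ex, p.2 + d * ey) T.
Proof.
move=> u0 e1 tau0 tauT uv d.
have velocity e t : 0 <= t <= T -> int0 t (fun s => if s <= tau then umax * e else 0)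
    = umax * e * (if t <= tau then t else tau).
  move=> /andP[t0 tT]; case: ifP => ttau; first by rewrite int0_step_le ?t0.
  by rewrite int0_step_ge ?mul0r ?addr0// (ltW tau0) ltW// ltNge ttau.
have position e : int0 T (fun t => int0 t (fun s => if s <= tau then umax * e else 0))
    = d * e.
  by rewrite (eq_int0 (velocity e)) int0_ramp ?tau0// /d; field.
split; first exact: le_trans (ltW tau0) tauT.
exists (fun s => if s <= tau then umax * ex else 0), (fun s => if s <= tau then umax * ey else 0).
split; first exact: measurable_step.
split; first exact: measurable_step.
split.
  move=> t _; case: ifP => _; last by rewrite expr0n/= addr0 sqr_ge0.
  by rewrite !exprMn -mulrDr e1 mulr1.
split; last by rewrite !position.
move=> t tT; rewrite !velocity//; set s := if t <= tau then t else tau.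
have s_tau : 0 <= s <= tau.
  by case/andP: tT => t0 _; rewrite /s; case: ifP => [->|_]; rewrite ?t0 ?lexx ?ltW.
have us : 0 <= umax * s <= vmax.
  case/andP: s_tau => s0 stau; rewrite mulr_ge0//.
  exact: le_trans (ler_wpM2l u0 stau) uv.
have -> : (umax * ex * s) ^+ 2 + (umax * ey * s) ^+ 2 = (umax * s) ^+ 2 * (ex ^+ 2 + ey ^+ 2).
  by ring.
by rewrite e1 mulr1; nra.
Qed.

(* Thrust for vmax / umax when the distance allows reaching top speed, and
   otherwise for sqrt (2 d / umax), arriving at the end of the thrust phase. *)
Lemma DI_accel_time (vmax umax d : R) : 0 < vmax -> 0 < umax -> 0 < d ->
  exists tau : R, let T := d / (umax * tau) + tau / 2 in
  [/\ 0 < tau, umax * tau <= vmax, tau <= T & T <= d / vmax + vmax / (2 * umax)].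
Proof.
move=> v0 u0 d0; have [long|short] := leP (vmax ^+ 2 / (2 * umax)) d.
  exists (vmax / umax); have -> : d / (umax * (vmax / umax)) = d / vmax.
    by field; rewrite !gt_eqF.
  split; first exact: divr_gt0.
  - by rewrite mulrC divfK// gt_eqF.
  - rewrite -subr_ge0; have -> : d / vmax + vmax / umax / 2 - vmax / umax
        = (d - vmax ^+ 2 / (2 * umax)) / vmax by field; rewrite !gt_eqF.
    by rewrite divr_ge0 ?subr_ge0// ltW.
  - by rewrite (_ : vmax / umax / 2 = vmax / (2 * umax))//; field; rewrite gt_eqF.
set r := Num.sqrt (2 * d / umax); exists r.
have r0 : 0 < r by rewrite sqrtr_gt0 divr_gt0 ?mulr_gt0.
have r2 : r ^+ 2 = 2 * d / umax by rewrite sqr_sqrtr// divr_ge0 ?mulr_ge0 ?ltW.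
have -> : d / (umax * r) + r / 2 = r.
  have -> : d = umax * r ^+ 2 / 2 by rewrite r2; field; rewrite gt_eqF.
  by field; rewrite !gt_eqF.
split=> //.
- have ur2 : (umax * r) ^+ 2 <= vmax ^+ 2.
    rewrite exprMn r2 (_ : umax ^+ 2 * _ = 2 * d * umax); last by field; rewrite gt_eqF.
    by move: short; rewrite ltr_pdivlMr ?mulr_gt0//; lra.
  by have := mulr_gt0 u0 r0; nra.
- have am_gm : r ^+ 2 <= (d / vmax + vmax / (2 * umax)) ^+ 2.
    have -> : r ^+ 2 = 4 * (d / vmax) * (vmax / (2 * umax)) by rewrite r2; field; rewrite !gt_eqF.
    by have := sqr_ge0 (d / vmax - vmax / (2 * umax)); nra.
  have : 0 < d / vmax + vmax / (2 * umax) by rewrite addr_gt0 ?divr_gt0 ?mulr_gt0.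
  nra.
Qed.

Lemma DI_time_le (vmax umax : R) p q : 0 < vmax -> 0 < umax ->
  (DI_time vmax umax p q <= (dist p q / vmax + vmax / (2 * umax))%:E)%E.
Proof.
move=> v0 u0; have [/dist_eq0 ->|dne0] := eqVneq (dist p q) 0.
  apply: le_trans (ereal_inf_lbound _) _; first by exists 0; first exact: DI_reach_rest.
  by rewrite lee_fin addr_ge0 ?divr_ge0 ?mulr_ge0 ?sqrtr_ge0 ?ltW.
have d0 : 0 < dist p q by rewrite lt_neqAle eq_sym dne0 sqrtr_ge0.
have [tau /= [tau0 utau tauT Tle]] := DI_accel_time v0 u0 d0.
have [ex [ey [e1 qx qy]]] := dist_dir p q.
have := DI_reach_accel_coast p (ltW u0) e1 tau0 tauT utau.
rewrite /= (_ : umax * tau * (_ - tau / 2) = dist p q); last by field; rewrite !gt_eqF.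
rewrite -qx -qy -surjective_pairing => reach.
by apply: le_trans (ereal_inf_lbound _) _; [exists (dist p q / (umax * tau) + tau / 2)|].
Qed.

End DI_travel_time.

Section DD_travel_time.
Variable R : realType.
Implicit Types p q : pt R.

Lemma rotation_to_unit (th ex ey : R) : ex ^+ 2 + ey ^+ 2 = 1 ->
  0 <= cos th * ex + sin th * ey ->
  exists2 D : R, `|D| <= pi / 2 & ex = cos (th + D) /\ ey = sin (th + D).
Proof.
move=> e1 c0; set c := cos th * ex + sin th * ey; set s := cos th * ey - sin th * ex.
have cs1 : c ^+ 2 + s ^+ 2 = 1.
  rewrite -e1 -[RHS]mul1r -(cos2Dsin2 th) /c /s; ring.
have s_itv : -1 <= s <= 1 by apply/andP; split; nra.
exists (asin s); first by rewrite ler_norml asin_geNpi2 ?asin_lepi2.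
have sin_turn : sin (asin s) = s by rewrite asinK// in_itv.
have cos_turn : cos (asin s) = c.
  by rewrite cos_asin// -cs1 addrK sqrtr_sqr ger0_norm.
have u1 := cos2Dsin2 th.
rewrite cosD sinD cos_turn sin_turn /c /s.
by split; rewrite -[LHS]mulr1 -u1; ring.
Qed.

(* A DD robot may drive backwards, so its heading only has to match the
   direction of travel up to sign. *)
Lemma unit_turn (th ex ey : R) : ex ^+ 2 + ey ^+ 2 = 1 -> exists sg D : R,
  [/\ `|sg| = 1, `|D| <= pi / 2, ex = sg * cos (th + D) & ey = sg * sin (th + D)].
Proof.
move=> e1; have [c0|c0] := leP 0 (cos th * ex + sin th * ey).
  have [D D_le [-> ->]] := rotation_to_unit e1 c0.
  by exists 1, D; rewrite normr1 !mul1r.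
have e1' : (- ex) ^+ 2 + (- ey) ^+ 2 = 1 by rewrite !sqrrN.
have c0' : 0 <= cos th * - ex + sin th * - ey by rewrite !mulrN -opprD oppr_ge0 ltW.
have [D D_le [exE eyE]] := rotation_to_unit e1' c0'.
by exists (-1), D; rewrite normrN normr1 !mulN1r -exE -eyE !opprK.
Qed.

(* Spin in place through D with opposite wheel speeds, then drive straight. *)
Lemma DD_reach_turn_drive (wmax rho : R) p (th D v t2 : R) :
  0 < wmax -> 0 < rho -> `|v| <= wmax -> 0 <= t2 ->
  let t1 := `|D| * rho / wmax in
  DD_reach wmax rho p th
    (p.1 + v * t2 * cos (th + D), p.2 + v * t2 * sin (th + D)) (t1 + t2).
Proof.
move=> w0 rho0 vw t20 t1.
have t10 : 0 <= t1 := divr_ge0 (mulr_ge0 (normr_ge0 D) (ltW rho0)) (ltW w0).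
have t1T : 0 <= t1 <= t1 + t2 by rewrite t10 lerDl.
set g := Num.sg D.
set wl := fun s => if s <= t1 then - (g * wmax) else v.
set wr := fun s => if s <= t1 then g * wmax else v.
have heading t : t1 <= t ->
    th + int0 t (fun s => (wr s - wl s) / (2 * rho)) = th + D.
  move=> t1t; rewrite (@eq_int0 _ _ _ (fun s => if s <= t1 then g * wmax / rho else 0)).
    rewrite int0_step_ge ?t10// mul0r addr0 /t1 [in RHS](numEsg D) -/g.
    by congr (_ + _); field; rewrite !gt_eqF.
  move=> s _; rewrite /wl /wr; case: ifP => _; last by rewrite subrr mul0r.
  by field; rewrite gt_eqF.
have drive (f : R -> R) : int0 (t1 + t2) (fun t => (wl t + wr t) / 2
      * f (th + int0 t (fun s => (wr s - wl s) / (2 * rho)))) = v * t2 * f (th + D).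
  rewrite (@eq_int0 _ _ _ (fun t => if t <= t1 then 0 else v * f (th + D))).
    by rewrite int0_step_ge// mul0r add0r addrAC subrr add0r mulrAC.
  move=> t _; rewrite /wl /wr; case: ifP => [_|/negbT]; first by rewrite addNr !mul0r.
  by rewrite -ltNge => /ltW /heading ->; congr (_ * _); field.
split; first exact: addr_ge0.
exists wl, wr; split; first exact: measurable_step.
split; first exact: measurable_step.
split; last by rewrite /= !drive.
have gw : `|g * wmax| <= wmax.
  rewrite normrM /g normr_sg (ger0_norm (ltW w0)).
  by case: (D != 0); rewrite ?mul1r ?mul0r// ltW.
by move=> t _; rewrite /wl /wr; case: ifP => _; rewrite ?normrN.
Qed.

Lemma DD_time_le (wmax rho : R) p (th : R) q : 0 < wmax -> 0 < rho ->
  (DD_time wmax rho p th q <= (dist p q / wmax + rho * pi / (2 * wmax))%:E)%E.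
Proof.
move=> w0 rho0; have [ex [ey [e1 qx qy]]] := dist_dir p q.
have [sg [D [sg1 D_le exE eyE]]] := unit_turn th e1.
have vw : `|sg * wmax| <= wmax by rewrite normrM sg1 mul1r ger0_norm // ltW.
have t20 : 0 <= dist p q / wmax := divr_ge0 (sqrtr_ge0 _) (ltW w0).
have := DD_reach_turn_drive p th D w0 rho0 vw t20.
have -> : sg * wmax * (dist p q / wmax) = dist p q * sg by field; rewrite gt_eqF.
rewrite /= -![dist p q * sg * _]mulrA -exE -eyE -qx -qy -surjective_pairing => reach.
apply: le_trans (ereal_inf_lbound _) _; first by exists (`|D| * rho / wmax + dist p q / wmax).
rewrite lee_fin addrC lerD2l (_ : rho * pi / (2 * wmax) = pi / 2 * rho / wmax).
  by rewrite ler_pM2r ?invr_gt0// ler_pM2r.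
by field; rewrite gt_eqF.
Qed.

End DD_travel_time.

Section ge0_le_integral_nonmeasurable.
Context d (T : measurableType d) (R : realType) (mu : {measure set T -> \bar R}).
Local Open Scope ereal_scope.

(* The integrand of the coverage cost is not known to be measurable, so the
   library's [ge0_le_integral] does not apply. *)
Lemma ge0_le_integral_nonmeasurable (D : set T) (f g : T -> \bar R) :
  (forall x, D x -> 0 <= f x) -> (forall x, D x -> f x <= g x) ->
  \int[mu]_(x in D) f x <= \int[mu]_(x in D) g x.
Proof.
move=> f0 fg; have g0 x : D x -> 0 <= g x by move=> Dx; exact: le_trans (f0 _ Dx) (fg _ Dx).
rewrite !ge0_integralE//; apply: ereal_sup_le => _ [h /= hf <-]; exists h => //= x.
apply: le_trans (hf x) _; rewrite /patch; case: ifP => // /set_mem; exact: fg.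
Qed.

End ge0_le_integral_nonmeasurable.

Section median_cost.
Variable R : realType.
Implicit Types (p q : pt R) (Q : set (pt R)).

Lemma squareE (a b s : R) : square a b s = `[a, a + s]%classic `*` `[b, b + s]%classic.
Proof. by apply/seteqP; split => -[x y]; rewrite /square/= !in_itv. Qed.

Lemma measurable_square (a b s : R) : measurable (square a b s).
Proof. by rewrite squareE; apply: measurableX; exact: measurable_itv. Qed.

Lemma leb2_square (a b s : R) : 0 < s -> leb2 (square a b s) = (s ^+ 2)%:E.
Proof.
move=> s0; rewrite squareE /leb2 product_measure1E; try exact: measurable_itv.
rewrite /leb/= (lebesgue_measure_itv `[a, a + s]) (lebesgue_measure_itv `[b, b + s])/=.
by rewrite !lte_fin !ltrDl s0 -!EFinD -EFinM !(addrC _ (- _)) !addKr expr2.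
Qed.

Lemma measurable_dist p : measurable_fun setT (dist p).
Proof.
apply: measurableT_comp (continuous_measurable_fun (@sqrt_continuous R)) _.
by apply: measurable_funD; apply: measurable_funX; apply: measurable_funB.
Qed.

Local Open Scope ereal_scope.

Definition nearest_dist m (ps : 'I_m -> pt R) q : \bar R :=
  \big[Order.min/+oo]_(i < m) (dist (ps i) q)%:E.

Lemma measurable_nearest_dist m (ps : 'I_m -> pt R) :
  measurable_fun setT (nearest_dist ps).
Proof.
rewrite /nearest_dist; elim: (index_enum _) => [|i r IH].
  by under eq_fun do rewrite big_nil; exact: measurable_cst.
under eq_fun do rewrite big_cons.
by apply: measurable_mine => //; apply/measurable_EFinP; exact: measurable_dist.
Qed.

Lemma nearest_dist_ge0 m (ps : 'I_m -> pt R) q : 0 <= nearest_dist ps q.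
Proof.
rewrite /nearest_dist; elim/big_ind: _ => // [x y x0 y0|i _].
  by rewrite /Order.min; case: ifP.
by rewrite lee_fin sqrtr_ge0.
Qed.

Lemma Hstar_median m Q (A : R) (ps : 'I_m -> pt R) :
  is_median Q A ps -> Hstar m Q A = Hm Q A ps.
Proof.
move=> [Qps ps_min]; apply/eqP; rewrite eq_le; apply/andP; split.
  by apply: ereal_inf_lbound; exists ps.
by apply/ereal_infP => _ [ps' Qps' <-]; exact: ps_min.
Qed.

Section coverage_cost.
Variables (m : nat) (ps : 'I_m -> pt R) (tau : 'I_m -> pt R -> \bar R) (c : R).
Hypothesis c0 : (0 < c)%R.

Lemma nearest_dist_le_assigned q :
  (forall i, (dist (ps i) q / c)%:E <= tau i q) ->
  nearest_dist ps q * (c^-1)%:E <= \big[Order.min/+oo]_(i < m | closest ps q i) tau i q.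
Proof.
move=> tau_ge; apply: le_bigmin => [|i _]; first exact: leey.
apply: le_trans (tau_ge i); rewrite EFinM lee_wpmul2r ?lee_fin ?invr_ge0 ?(ltW c0)//.
exact: bigmin_le.
Qed.

Lemma assigned_le_nearest_dist (K : R) q : (0 < m)%N ->
  (forall i, tau i q <= (dist (ps i) q / c + K)%:E) ->
  \big[Order.min/+oo]_(i < m | closest ps q i) tau i q <= nearest_dist ps q * (c^-1)%:E + K%:E.
Proof.
move=> m0 tau_le.
have [i0 _ nearest_i0] := @eq_bigmin _ _ _ +oo (Ordinal m0) xpredT
  (fun i => (dist (ps i) q)%:E) erefl (fun i _ => leey _).
have closest_i0 : closest ps q i0.
  by apply/forallP => j; rewrite -lee_fin -nearest_i0; exact: bigmin_le.
rewrite /nearest_dist nearest_i0 -EFinM -EFinD.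
exact: le_trans (bigmin_le_cond _ _ closest_i0) (tau_le i0).
Qed.

Variables (Q : set (pt R)) (A : R).
Hypotheses (mQ : measurable Q) (median : is_median Q A ps).
Hypothesis tau_ge : forall i q, (dist (ps i) q / c)%:E <= tau i q.

Lemma MS_cost_ge : (0 <= A)%R -> Hstar m Q A * (c^-1)%:E <= MS_cost Q A ps tau.
Proof.
move=> A0; have ic0 : (0 <= c^-1)%R by rewrite invr_ge0 ltW.
rewrite (Hstar_median median) -muleA lee_wpmul2l ?lee_fin ?invr_ge0//.
rewrite -ge0_integralZr ?lee_fin//; last 2 first.
- exact: measurable_funS (measurable_nearest_dist ps).
- by move=> q _; exact: nearest_dist_ge0.
apply: ge0_le_integral_nonmeasurable => q _; last exact: nearest_dist_le_assigned.
by rewrite mule_ge0 ?nearest_dist_ge0 ?lee_fin.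
Qed.

Lemma MS_cost_le (K : R) : (0 < m)%N -> (0 < A)%R -> leb2 Q = A%:E -> (0 <= K)%R ->
  (forall i q, tau i q <= (dist (ps i) q / c + K)%:E) ->
  MS_cost Q A ps tau <= Hstar m Q A * (c^-1)%:E + K%:E.
Proof.
move=> m0 A0 QA K0 tau_le; rewrite (Hstar_median median).
have ic0 : (0 <= c^-1)%R by rewrite invr_ge0 ltW.
have iA0 : (0 <= A^-1)%R by rewrite invr_ge0 ltW.
have nc0 q : 0 <= nearest_dist ps q * (c^-1)%:E by rewrite mule_ge0 ?nearest_dist_ge0 ?lee_fin.
apply: le_trans (_ : (A^-1)%:E * \int[@leb2 R]_(q in Q) (nearest_dist ps q * (c^-1)%:E + K%:E) <= _).
  rewrite lee_wpmul2l ?lee_fin//; apply: ge0_le_integral_nonmeasurable => q _.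
    exact: le_trans (nc0 q) (nearest_dist_le_assigned (tau_ge^~ q)).
  exact: assigned_le_nearest_dist.
have mnc : measurable_fun Q (fun q => nearest_dist ps q * (c^-1)%:E).
  exact: emeasurable_funM (measurable_funS _ _ (measurable_nearest_dist ps)) (measurable_cst _).
rewrite ge0_integralD// ?lee_fin//.
have -> : \int[@leb2 R]_(_ in Q) K%:E = K%:E * A%:E.
  by rewrite integral_cst//; congr (_ * _); exact: QA.
rewrite ge0_integralZr ?lee_fin//; last 2 first.
- exact: measurable_funS (measurable_nearest_dist ps).
- by move=> q _; exact: nearest_dist_ge0.
rewrite ge0_muleDr ?mule_ge0 ?integral_ge0 ?lee_fin ?(ltW A0)// => [|q _]; last first.
  exact: nearest_dist_ge0.
by rewrite muleA -!EFinM mulrCA mulVf ?mulr1// gt_eqF.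
Qed.

End coverage_cost.

End median_cost.

Theorem theorem2 (R : realType) (a b s : R) (hs : 0 < s)
    (m : nat) (hm : (0 < m)%N)
    (vmax umax wmax rho : R)
    (hv : 0 < vmax) (hu : 0 < umax) (hw : 0 < wmax) (hrho : 0 < rho)
    (pstar : 'I_m -> pt R) (hmed : is_median (square a b s) (s ^+ 2) pstar)
    (theta : 'I_m -> R) :
  let Q := square a b s in
  let A := s ^+ 2 in
  let H := Hstar m Q A in
  let T_DI := MS_cost Q A pstar (fun i q => DI_time vmax umax (pstar i) q) in
  let T_DD := MS_cost Q A pstar (fun i q => DD_time wmax rho (pstar i) (theta i) q) in
  ((H * (vmax^-1)%:E <= T_DI)%E /\
   (T_DI <= H * (vmax^-1)%:E
            + (vmax / (2 * umax) + Num.sqrt (2 * Num.sqrt (2 * A) / umax))%:E)%E) /\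
  ((H * (wmax^-1)%:E <= T_DD)%E /\
   (T_DD <= H * (wmax^-1)%:E + (rho * pi / (2 * wmax))%:E)%E).
Proof.
move=> Q A H T_DI T_DD; rewrite {}/H {}/T_DI {}/T_DD.
have mQ := measurable_square a b s; have QA := leb2_square a b hs.
have A0 : 0 < A := exprn_gt0 2 hs.
have DI_ge i q := DI_time_ge (pstar i) q hv hu.
have DI_le i q := DI_time_le (pstar i) q hv hu.
have DD_ge i q := DD_time_ge (pstar i) (theta i) q hw hrho.
have DD_le i q := DD_time_le (pstar i) (theta i) q hw hrho.
have K_DI : 0 <= vmax / (2 * umax) by rewrite divr_ge0 ?mulr_ge0 ?ltW.
have K_DD : 0 <= rho * pi / (2 * wmax) by rewrite divr_ge0 ?mulr_ge0 ?pi_ge0 ?ltW.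
split; split.
- exact (MS_cost_ge hv mQ hmed DI_ge (ltW A0)).
- apply: le_trans (MS_cost_le hv mQ hmed DI_ge hm A0 QA K_DI DI_le) _.
  by apply: leeD; rewrite // lee_fin lerDl sqrtr_ge0.
- exact (MS_cost_ge hw mQ hmed DD_ge (ltW A0)).
- exact (MS_cost_le hw mQ hmed DD_ge hm A0 QA K_DD DD_le).
Qed.
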